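(* For integers $n\ge 1$ and $i\ge 0$, let $C_{n,i}$ be the number of elements of $Q_n$ with exactly $i$ descents, and let $c_{n,i}$ be the number of elements of $Q_n$ with exactly $i$ plateaux. Then for all integers $n,i\geq 2$, $$C_{n,i}=iC_{n-1,i}+(2n-i)C_{n-1,i-1}$$ and $$c_{n,i}=ic_{n-1,i}+(2n-i)c_{n-1,i-1}.$$ In particular (since $C_{1,1}=c_{1,1}=1$ and $C_{1,0}=c_{1,0}=0$), the identity $C_{n,i}=c_{n,i}$ holds for all $n\ge 1$ and $i\ge 0$.
   Context: For a positive integer $n$, $Q_n$ denotes the set of Stirling permutations: all permutations $q=a_1a_2\cdots a_{2n}$ of the multiset $\{1,1,2,2,\ldots,n,n\}$ such that for every $i\in\{1,\dots,n\}$, all entries located between the two occurrences of $i$ are larger than $i$. (For example $Q_2=\{1122,1221,2211\}$.) An index $i$ with $1\le i\le 2n$ is a descent of $q$ if $i=2n$ or $a_i>a_{i+1}$; thus $i=2n$ always counts as a descent. An index $i$ with $1\le i\le 2n-1$ is a plateau of $q$ if $a_i=a_{i+1}$. *)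

(* Defs.v *)
From mathcomp Require Import all_boot all_order all_algebra.

Set Implicit Arguments.
Unset Strict Implicit.
Unset Printing Implicit Defensive.

(* The multiset {1,1,2,2,...,n,n}. *)
Definition double_multiset (n : nat) : seq nat :=
  flatten [seq [:: k; k] | k <- iota 1 n].

(* a_i, with the positions of a word numbered from 1. *)
Definition letter (q : seq nat) (i : nat) : nat := nth 0 q i.-1.

(* In a permutation of [double_multiset n], distinct positions j < l carrying
   the same letter are exactly the two occurrences of that letter. *)
Definition stirling_cond (q : seq nat) : bool :=
  all (fun j => all (fun k => all (fun l =>
      [&& j < k, k < l & letter q j == letter q l] ==> (letter q j < letter q k))
    (iota 1 (size q))) (iota 1 (size q))) (iota 1 (size q)).

(* [permutations s] lists each distinct rearrangement of the multiset [s] once,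
   so counting in this list is counting elements of Q_n. *)
Definition stirling_perms (n : nat) : seq (seq nat) :=
  [seq q <- permutations (double_multiset n) | stirling_cond q].

Definition is_descent (q : seq nat) (i : nat) : bool :=
  [&& 1 <= i, i <= size q & (i == size q) || (letter q i.+1 < letter q i)].

Definition is_plateau (q : seq nat) (i : nat) : bool :=
  [&& 1 <= i, i < size q & letter q i == letter q i.+1].

Definition descents (q : seq nat) : nat := count (is_descent q) (iota 1 (size q)).

Definition plateaux (q : seq nat) : nat := count (is_plateau q) (iota 1 (size q)).

Definition num_descents (n i : nat) : nat :=
  count (fun q => descents q == i) (stirling_perms n).

Definition num_plateaux (n i : nat) : nat :=
  count (fun q => plateaux q == i) (stirling_perms n).

(* Main.v *)
Require Import Defs.
From mathcomp Require Import all_boot all_order all_algebra.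
From mathcomp Require Import zify.

(* In a Stirling permutation of order n the two letters n are adjacent, so each
   one arises exactly once by inserting the block nn into one of the 2n-1 gaps
   of a Stirling permutation of order n-1.  Pad a word with a letter 0 at both
   ends: descents (resp. plateaux) are then the gaps whose adjacent letters
   (x, y) satisfy x > y (resp. x = y).  Inserting nn replaces the gap (x, y) by
   the gaps (x, n), (n, n), (n, y), exactly one of which is a descent (resp. a
   plateau); so the statistic is unchanged if the chosen gap was counted and
   grows by one otherwise.  Both statistics thus obey the same recurrence. *)

Set Implicit Arguments.
Unset Strict Implicit.
Unset Printing Implicit Defensive.

(** * The Stirling condition as a condition on subsequences *)

Lemma subseq_consP (T : eqType) (x0 x : T) (s q : seq T) :
  subseq (x :: s) q <->
  exists j, [/\ j < size q, nth x0 q j = x & subseq s (drop j.+1 q)].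
Proof.
split=> [|[j [lt_j <- sub_s]]]; last first.
  rewrite -{2}(cat_take_drop j q) (drop_nth x0 lt_j).
  apply: subseq_trans (suffix_subseq _ _).
  by rewrite /= eqxx.
elim: q => [//|y q IHq] /=.
case: eqP => [-> sub_s|_ /IHq [j [lt_j eq_x sub_s]]].
  by exists 0; rewrite /= drop0.
by exists j.+1.
Qed.

(** Removing the indices makes the condition visibly inherited by subsequences, which suits
    insertion and deletion of letters. *)
Lemma stirling_condP (q : seq nat) :
  reflect (forall x y, subseq [:: x; y; x] q -> x < y) (stirling_cond q).
Proof.
apply: (iffP idP) => [st_q x y | sub_q].
  case/(subseq_consP 0) => j [lt_j eq_j].
  case/(subseq_consP 0) => k []; rewrite size_drop nth_drop drop_drop.
  move=> lt_k eq_k /(subseq_consP 0) [l []].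
  rewrite size_drop nth_drop => lt_l eq_l _.
  have in_range i : i < size q -> i.+1 \in iota 1 (size q) by rewrite mem_iota.
  have lt_jk : j.+1 + k < size q by rewrite -ltn_subRL.
  have lt_jkl : k.+1 + j.+1 + l < size q by rewrite -ltn_subRL.
  move/allP: st_q => /(_ _ (in_range _ lt_j)) /allP /(_ _ (in_range _ lt_jk)).
  move/allP => /(_ _ (in_range _ lt_jkl)).
  rewrite /letter /= eq_j eq_k eq_l eqxx andbT => /implyP; apply.
  by lia.
apply/allP => j; rewrite mem_iota => Hj; apply/allP => k; rewrite mem_iota => Hk.
apply/allP => l; rewrite mem_iota => Hl; apply/implyP => /and3P [ltjk ltkl /eqP eq_jl].
apply: sub_q; rewrite {2}eq_jl /letter.
(* [letter] numbers positions from 1, so the 0-based offsets are [j.-1], then [k - j.+1] after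
   dropping [j] letters, then [l - k.+1] after dropping [k]. *)
apply/(subseq_consP 0); exists j.-1; split=> //=; first lia.
apply/(subseq_consP 0); exists (k - j.+1); rewrite size_drop nth_drop.
split=> /=; [lia | congr nth; lia |].
rewrite drop_drop sub1seq.
have -> : nth 0 q l.-1 = nth 0 (drop ((k - j.+1).+1 + j.-1.+1) q) (l - k.+1).
  by rewrite nth_drop; congr nth; lia.
by rewrite mem_nth // size_drop /=; lia.
Qed.

(** * Insertion of a block of two maximal letters *)

Definition insert_pair (N p : nat) (q : seq nat) : seq nat :=
  take p q ++ [:: N, N & drop p q].

(** Forwards, [q] is a subsequence of the enlarged word. Backwards, a pattern [x y x] cannot have
    [x = N], as the only two [N] are adjacent; if [y = N] then [x < N] holds by maximality;
    otherwise the pattern survives deletion of [N] and lies in [q]. *)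
Lemma stirling_cond_insert_pair N p q :
  all (gtn N) q -> stirling_cond (insert_pair N p q) = stirling_cond q.
Proof.
move=> /allP ltN; rewrite /insert_pair.
have memN : N \notin q by apply/negP => /ltN /=; rewrite ltnn.
have [Na Nb] : N \notin take p q /\ N \notin drop p q.
  by split; apply: contra memN; [apply: mem_take | apply: mem_drop].
apply/stirling_condP/stirling_condP => st x y sub_q.
  apply: st; apply: subseq_trans sub_q _.
  rewrite -{1}(cat_take_drop p q) cat_subseq //.
  exact: (@suffix_subseq _ [:: N; N]).
have [xN|xN] := eqVneq x N.
  have /negP [] : ~~ subseq [:: x; y; x] (take p q ++ [:: N, N & drop p q]).
    rewrite xN; elim: (take p q) Na => [_|z a IHa].
      rewrite [_ ++ _]/= [subseq _ _]/= eqxx; case: eqP => [_|_].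
        by rewrite sub1seq.
      by apply: contra Nb => /mem_subseq; apply; rewrite !inE eqxx orbT.
    by rewrite inE negb_or [subseq _ _]/= => /andP [/negPf -> /IHa].
  exact: sub_q.
have x_in : x \in q.
  have := mem_subseq sub_q (mem_head _ _).
  by rewrite mem_cat !inE (negPf xN) /= -mem_cat cat_take_drop.
have [->|yN] := eqVneq y N; first exact: ltN.
apply: st.
have : subseq (filter (predC1 N) [:: x; y; x])
              (filter (predC1 N) (take p q ++ [:: N, N & drop p q])).
  by rewrite subseq_filter filter_all /= xN yN.
rewrite filter_cat /= xN yN eqxx /= -filter_cat cat_take_drop.
by move/subseq_trans; apply; apply: filter_subseq.
Qed.

Lemma perm_insert_pair N p q : perm_eq (insert_pair N p q) (q ++ [:: N; N]).
Proof.
rewrite /insert_pair -{3}(cat_take_drop p q) -catA perm_cat2l.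
exact/permPl/(perm_catC [:: N; N]).
Qed.

Lemma double_multisetS n :
  double_multiset n.+1 = double_multiset n ++ [:: n.+1; n.+1].
Proof. by rewrite /double_multiset -{1}(addn1 n) iotaD map_cat flatten_cat. Qed.

Lemma mem_double_multiset n x : (x \in double_multiset n) = (0 < x <= n).
Proof.
elim: n => [|n IHn]; first by rewrite in_nil; lia.
by rewrite double_multisetS mem_cat IHn !inE; lia.
Qed.

Lemma size_double_multiset n : size (double_multiset n) = 2 * n.
Proof.
by elim: n => [//|n IHn]; rewrite double_multisetS size_cat IHn /=; lia.
Qed.

Lemma mem_stirling_perms n q :
  (q \in stirling_perms n) = stirling_cond q && perm_eq q (double_multiset n).
Proof. by rewrite mem_filter mem_permutations. Qed.

Lemma stirling_letters n (q : seq nat) x :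
  q \in stirling_perms n -> (x \in q) = (0 < x <= n).
Proof.
by rewrite mem_stirling_perms => /andP [_ /perm_mem ->]; rewrite mem_double_multiset.
Qed.

Lemma stirling_pos n (q : seq nat) i :
  q \in stirling_perms n -> i < size q -> 0 < nth 0 q i.
Proof. by move=> q_in /(mem_nth 0); rewrite (stirling_letters _ q_in) => /andP []. Qed.

Lemma size_stirling n (q : seq nat) : q \in stirling_perms n -> size q = 2 * n.
Proof.
by rewrite mem_stirling_perms => /andP [_ /perm_size ->]; rewrite size_double_multiset.
Qed.

Lemma stirling_lt n (q : seq nat) : q \in stirling_perms n -> all (gtn n.+1) q.
Proof. by move=> q_in; apply/allP => x; rewrite (stirling_letters _ q_in) /=; lia. Qed.

Lemma insert_pair_stirling n p q :
  all (gtn n.+1) q ->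
  (insert_pair n.+1 p q \in stirling_perms n.+1) = (q \in stirling_perms n).
Proof.
move=> ltq; rewrite !mem_stirling_perms stirling_cond_insert_pair //.
by rewrite double_multisetS (permPl (perm_insert_pair _ _ _)) perm_cat2r.
Qed.

(** A letter between the two copies of [n.+1] would have to exceed [n.+1], the largest letter, so
    the copies are adjacent and can be removed together. *)
Lemma stirling_insert_pair n (q : seq nat) : q \in stirling_perms n.+1 ->
  exists2 q', q' \in stirling_perms n &
    exists2 p, p < (2 * n).+1 & q = insert_pair n.+1 p q'.
Proof.
move=> q_in; have := q_in; rewrite mem_stirling_perms.
case/andP => /stirling_condP st_q perm_q.
have cntN : count_mem n.+1 q = 2.
  rewrite (permP perm_q) double_multisetS count_cat /= eqxx.
  suff /count_memPn -> : n.+1 \notin double_multiset n by [].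
  by rewrite mem_double_multiset; lia.
(* Split at one occurrence; since the letter occurs twice, the other copy lies either to the right
   or to the left. *)
have [a [c [b def_q]]] : exists a c b, q = a ++ n.+1 :: c ++ n.+1 :: b.
  have : n.+1 \in q by rewrite -has_pred1 has_count cntN.
  move=> Nq; case/path.splitPr: q / Nq cntN {perm_q q_in st_q} => a b.
  rewrite count_cat /= eqxx => cntN.
  have [|/count_memPn cb] := boolP (n.+1 \in b).
    by case/path.splitPr=> c d; exists a, c, d.
  have : n.+1 \in a by rewrite -has_pred1 has_count; case: count cntN; rewrite // cb.
  by case/path.splitPr=> d c; exists d, c, b; rewrite -catA.
case: c def_q => [|y c] def_q.
  have def_q' : q = insert_pair n.+1 (size a) (a ++ b).
    by rewrite /insert_pair take_size_cat // drop_size_cat.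
  have perm_ab : perm_eq (a ++ b) (double_multiset n).
    rewrite -(perm_cat2r [:: n.+1; n.+1]) -double_multisetS -(permPr perm_q).
    by rewrite def_q' perm_sym perm_insert_pair.
  exists (a ++ b); last exists (size a) => //.
    rewrite -(@insert_pair_stirling n (size a)) -?def_q' //.
    by apply/allP => x; rewrite (perm_mem perm_ab) mem_double_multiset /=; lia.
  by rewrite -size_double_multiset -(perm_size perm_ab) size_cat ltnS leq_addr.
have /st_q : subseq [:: n.+1; y; n.+1] q.
  rewrite def_q; apply: subseq_trans (suffix_subseq a _).
  by rewrite /= !eqxx sub1seq mem_cat mem_head orbT.
have : y \in q by rewrite def_q mem_cat !inE eqxx !orbT.
by rewrite (stirling_letters _ q_in); lia.
Qed.

(** Deleting [N] recovers the word, and the index of the first [N] recovers the gap. *)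
Lemma insert_pair_inj N p q p' q' :
  N \notin q -> N \notin q' -> p <= size q -> p' <= size q' ->
  insert_pair N p q = insert_pair N p' q' -> q = q' /\ p = p'.
Proof.
move=> Nq Nq' le_p le_p' eq_ins; split.
  have filterN s k : N \notin s -> filter (predC1 N) (insert_pair N k s) = s.
    move=> Ns; rewrite filter_cat /= eqxx /= -filter_cat cat_take_drop.
    by apply/all_filterP/allP => x xs; apply: contraNneq Ns => <-.
  by rewrite -(filterN q p Nq) eq_ins filterN.
have indexN s k : N \notin s -> k <= size s -> index N (insert_pair N k s) = k.
  move=> Ns le_k; rewrite index_cat /= eqxx addn0 size_takel //.
  by rewrite ifN //; apply: contra Ns; apply: mem_take.
by rewrite -(indexN q p) // eq_ins indexN.
Qed.

Lemma perm_stirlingS n :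
  perm_eq (stirling_perms n.+1)
    [seq insert_pair n.+1 p q | q <- stirling_perms n, p <- iota 0 (2 * n).+1].
Proof.
have notin q : q \in stirling_perms n -> n.+1 \notin q.
  by move=> q_in; rewrite (stirling_letters _ q_in); lia.
have uniq_st m : uniq (stirling_perms m) by rewrite filter_uniq ?permutations_uniq.
apply: uniq_perm => //.
  apply: allpairs_uniq => //; first exact: iota_uniq.
  move=> _ _ /allpairsP [[q p] [q_in p_in ->]] /allpairsP [[q' p'] [q'_in p'_in ->]].
  move: (q_in : q \in _) (q'_in : q' \in _) => {}q_in {}q'_in.
  move: (p_in : p \in _) (p'_in : p' \in _); rewrite !mem_iota => {}p_in {}p'_in.
  case/insert_pair_inj; rewrite ?notin ?(size_stirling q_in) ?(size_stirling q'_in) //.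
  by move=> -> ->.
move=> q; apply/idP/allpairsP => [|[[q' p] /= [q'_in _ ->]]].
  case/stirling_insert_pair=> q' q'_in [p lt_p ->].
  by exists (q', p); rewrite mem_iota.
by rewrite insert_pair_stirling ?stirling_lt.
Qed.

(** * Descents and plateaux as gap statistics *)

Definition gaps (r : rel nat) (q : seq nat) : seq bool :=
  pairmap r 0 (rcons q 0).

Definition gap_count (r : rel nat) (q : seq nat) : nat := count id (gaps r q).

Lemma size_gaps r q : size (gaps r q) = (size q).+1.
Proof. by rewrite size_pairmap size_rcons. Qed.

Lemma count_nth_iota (g : seq bool) : count (nth false g) (iota 0 (size g)) = count id g.
Proof. by rewrite -[in RHS](mkseq_nth false g) count_map. Qed.

Lemma gap_countE r q : gap_count r q =
  r 0 (head 0 q) + count (fun i => r (letter q i) (nth 0 q i)) (iota 1 (size q)).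
Proof.
rewrite /gap_count -count_nth_iota size_gaps /=; congr (_ + _).
  by case: q.
apply: eq_in_count => i; rewrite mem_iota => lt_i.
rewrite (nth_pairmap 0) ?size_rcons; last lia.
case: i lt_i => [|i] lt_i; first lia.
rewrite /= /letter /= !nth_rcons ifT; last lia.
(* Past the end of [q], the default 0 of [nth] agrees with the final padding letter. *)
by case: ltnP => // le_i; rewrite if_same (nth_default _ le_i).
Qed.

Lemma gap_count_descents n (q : seq nat) : 0 < n -> q \in stirling_perms n ->
  gap_count gtn q = descents q.
Proof.
move=> n_gt0 q_in; rewrite gap_countE add0n.
apply: eq_in_count => i; rewrite mem_iota => lt_i.
rewrite /is_descent /=; case: eqP => [eq_i|_]; last by rewrite [letter q i.+1]/letter /=; lia.
rewrite nth_default ?eq_i // /letter.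
by have := @stirling_pos _ _ (size q).-1 q_in; lia.
Qed.

(** As [q] is nonempty with positive letters, neither end gap joins equal letters. *)
Lemma gap_count_plateaux n (q : seq nat) : 0 < n -> q \in stirling_perms n ->
  gap_count eq_op q = plateaux q.
Proof.
move=> n_gt0 q_in; rewrite gap_countE.
have pos i := @stirling_pos _ _ i q_in.
have := pos 0; rewrite nth0 => pos0.
have -> : (0 == head 0 q) = false.
  by have := size_stirling q_in; lia.
apply: eq_in_count => i; rewrite mem_iota => lt_i.
rewrite /is_plateau /=; case: (ltngtP i (size q)) => //= [lti|gti|eq_i].
- by have -> : 0 < i by lia.
- by lia.
rewrite nth_default ?eq_i // andbF /letter.
by have := pos (size q).-1; lia.
Qed.

(** The one property shared by the two relations that drives the recurrence, so both statistics are
    treated at once. *)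
Definition splits_gap (r : rel nat) :=
  forall x y N, x < N -> y < N -> r x N + r N N + r N y = 1.

Lemma splits_gap_descent : splits_gap gtn.
Proof. by move=> x y N /=; lia. Qed.

Lemma splits_gap_plateau : splits_gap eq_op.
Proof. by move=> x y N /=; lia. Qed.

Lemma gap_count_insert_pair r N p q :
  splits_gap r -> 0 < N -> all (gtn N) q -> p <= size q ->
  gap_count r (insert_pair N p q) = gap_count r q + ~~ nth false (gaps r q) p.
Proof.
move=> split_r N_gt0 ltN le_p.
have := cat_take_drop p q; rewrite /insert_pair.
move: (take p q) (drop p q) (size_takel le_p) => a b size_a def_q.
have [y [b' def_b]] : exists y b', rcons b 0 = y :: b'.
  by case: b {def_q} => [|y b]; [exists 0, [::] | exists y, (rcons b 0)].
have def_g : gaps r q = pairmap r 0 a ++ r (last 0 a) y :: pairmap r y b'.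
  by rewrite /gaps -def_q rcons_cat def_b pairmap_cat.
rewrite /gap_count def_g /gaps rcons_cat !rcons_cons def_b pairmap_cat !count_cat /=.
rewrite nth_cat size_pairmap size_a ltnn subnn /=.
(* The padding 0 is included, so that the two end gaps are covered as well. *)
have ltq z : z \in 0 :: q -> z < N.
  by rewrite inE => /predU1P [->|/(allP ltN)].
have := split_r (last 0 a) y N; rewrite !ltq; first last.
- rewrite -def_q -cat_cons mem_cat; apply/orP; left; exact: mem_last.
- have : y \in rcons b 0 by rewrite def_b mem_head.
  by rewrite mem_rcons -def_q !inE mem_cat => /predU1P [->|->]; rewrite ?orbT.
by case: (r _ y) => /= /(_ isT isT); lia.
Qed.

(** * The recurrence for gap statistics *)

Definition num_gaps (r : rel nat) (n i : nat) : nat :=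
  count (fun q => gap_count r q == i) (stirling_perms n).

Lemma count_allpairs (S T U : Type) (f : S -> T -> U) a (s : seq S) (t : seq T) :
  count a [seq f x y | x <- s, y <- t] = \sum_(x <- s) count (fun y => a (f x y)) t.
Proof.
elim: s => [|x s IHs]; first by rewrite big_nil.
by rewrite big_cons -IHs /= count_cat count_map.
Qed.

Lemma gap_count_le r n (q : seq nat) : q \in stirling_perms n -> gap_count r q <= (2 * n).+1.
Proof.
by move=> q_in; rewrite -(size_stirling q_in) -(size_gaps r); apply: count_size.
Qed.

(** A word with [d] counted gaps has [d] insertions keeping the value and [2n+1-d] raising it to
    [d+1]; for [d = i-1] the latter number is [2(n+1)-i]. The factor [(0 < i)] kills the spurious
    term at [i = 0], where [i.-1] is again 0. *)
Lemma num_gapsS r n i : splits_gap r ->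
  num_gaps r n.+1 i =
    i * num_gaps r n i + (0 < i) * (2 * n.+1 - i) * num_gaps r n i.-1.
Proof.
move=> split_r; rewrite /num_gaps (permP (perm_stirlingS n)) count_allpairs.
rewrite -![in RHS]sum1_count !big_distrr.
(* With both sides written as sums over the words of order [n], the identity is checked word by
   word. *)
rewrite [in X in X + _]big_mkcond [in X in _ + X]big_mkcond -big_split.
apply: eq_big_seq => q q_in; rewrite [in RHS]/= !muln1.
have size_q := size_stirling q_in; have := gap_count_le r q_in.
rewrite -size_q -(size_gaps r) => le_d.
have := count_predC id (gaps r q); rewrite -/(gap_count r q).
have -> : count (predC id) (gaps r q) =
          count (predC (nth false (gaps r q))) (iota 0 (size (gaps r q))).
  by rewrite -[in LHS](mkseq_nth false (gaps r q)) count_map.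
have := count_nth_iota (gaps r q); rewrite -/(gap_count r q).
rewrite size_gaps size_q => cnt cntC.
transitivity (count (fun p => gap_count r q + ~~ nth false (gaps r q) p == i)
                (iota 0 (2 * n).+1)).
  apply: eq_in_count => p; rewrite mem_iota => lt_p.
  by rewrite gap_count_insert_pair ?stirling_lt ?size_q.
have [eq_d|ne_d] := eqVneq (gap_count r q) i.
  have -> : (if gap_count r q == i.-1 then (0 < i) * (2 * n.+1 - i) else 0) = 0.
    by rewrite eq_d; case: (i) => // j; rewrite ifN //=; lia.
  transitivity (count (nth false (gaps r q)) (iota 0 (2 * n).+1)).
    by apply: eq_count => p; case: nth; lia.
  by rewrite cnt addn0.
have [eq_d|ne_d'] := eqVneq (gap_count r q).+1 i.
  rewrite -eq_d [in RHS]/= eqxx.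
  transitivity (count (predC (nth false (gaps r q))) (iota 0 (2 * n).+1)); last by lia.
  by apply: eq_count => p /=; case: nth => /=; lia.
have -> : (if gap_count r q == i.-1 then (0 < i) * (2 * n.+1 - i) else 0) = 0.
  by case: ifP => //; case: (i) ne_d ne_d' => [|j] /=; lia.
rewrite (@eq_count _ _ pred0) ?count_pred0 // => p /=.
by case: nth; lia.
Qed.

Lemma num_gaps_large r n i : (2 * n).+1 < i -> num_gaps r n i = 0.
Proof.
move=> lt_i; apply/eqP; rewrite eqn0Ngt -has_count -all_predC.
by apply/allP => q /(gap_count_le r) /=; lia.
Qed.

Lemma num_gaps_rec r n i : splits_gap r -> 0 < n -> 0 < i ->
  ((num_gaps r n i)%:Z =
     i%:Z * (num_gaps r n.-1 i)%:Z
     + ((2 * n)%N%:Z - i%:Z) * (num_gaps r n.-1 i.-1)%:Z)%R.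
Proof.
move=> split_r; case: n => [//|n] _; case: i => [//|i] _.
rewrite num_gapsS //=.
(* Truncated and integer subtraction differ only when the coefficient is negative, and then the
   count it multiplies vanishes. *)
have [le_i|lt_i] := leqP i (2 * n).+1; last by rewrite (num_gaps_large r lt_i); lia.
have [k ->] : exists k, 2 * n.+1 = i.+1 + k by exists (2 * n.+1 - i.+1); lia.
by rewrite addKn; lia.
Qed.

(** * Return to descents and plateaux *)

Lemma num_descentsE n i : 0 < n -> num_descents n i = num_gaps gtn n i.
Proof.
by move=> n_gt0; apply: eq_in_count => q q_in; rewrite (gap_count_descents n_gt0).
Qed.

Lemma num_plateauxE n i : 0 < n -> num_plateaux n i = num_gaps eq_op n i.
Proof.
by move=> n_gt0; apply: eq_in_count => q q_in; rewrite (gap_count_plateaux n_gt0).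
Qed.

Lemma stirling_perms1 : stirling_perms 1 = [:: [:: 1; 1]].
Proof. by vm_compute. Qed.

(** The induction starts at order 1: for the empty word the single gap [(0, 0)] is counted by
    equality but not by [gtn]. *)
Lemma num_gaps_descent_plateau n i :
  0 < n -> num_gaps gtn n i = num_gaps eq_op n i.
Proof.
case: n => [//|n] _; elim: n i => [|n IHn] i.
  by rewrite /num_gaps stirling_perms1.
by rewrite (num_gapsS _ _ splits_gap_descent) (num_gapsS _ _ splits_gap_plateau) !IHn.
Qed.

Theorem proposition1 :
  (forall n i : nat, 2 <= n -> 2 <= i ->
     ((num_descents n i)%:Z =
        i%:Z * (num_descents n.-1 i)%:Z
        + ((2 * n)%N%:Z - i%:Z) * (num_descents n.-1 i.-1)%:Z)%R
     /\
     ((num_plateaux n i)%:Z =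
        i%:Z * (num_plateaux n.-1 i)%:Z
        + ((2 * n)%N%:Z - i%:Z) * (num_plateaux n.-1 i.-1)%:Z)%R)
  /\ [/\ num_descents 1 1 = 1, num_plateaux 1 1 = 1,
         num_descents 1 0 = 0 & num_plateaux 1 0 = 0]
  /\ (forall n i : nat, 1 <= n -> num_descents n i = num_plateaux n i).
Proof.
split=> [n i n_ge2 i_ge2|]; last split.
- rewrite !num_descentsE ?num_plateauxE; try lia.
  split; apply: num_gaps_rec; try lia.
    exact: splits_gap_descent.
  exact: splits_gap_plateau.
- by rewrite /num_descents /num_plateaux stirling_perms1.
- by move=> n i n_gt0; rewrite num_descentsE // num_plateauxE // num_gaps_descent_plateau.
Qed.
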